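(* Let $m\ge 1$, $I:=\{1,2,\dots,m\}$, let $T_i:\mathcal H\to\mathcal H$ be a $\lambda_i$-relaxed cutter, where $\lambda_i\in(0,+\infty)$, $i\in I$, and suppose $\bigcap_{i=1}^m \operatorname{Fix}T_i\neq\emptyset$. Let $w_i>0$, $i\in I$, with $\sum_{i=1}^m w_i=1$, and let $T:=\sum_{i=1}^m w_iT_i$. Then: (i) $T$ is a $\lambda$-relaxed cutter with $\lambda=\sum_{i=1}^m w_i\lambda_i$; (ii) $0<\min_{i\in I}\lambda_i\le\lambda\le\max_{i\in I}\lambda_i<+\infty$; (iii) $\operatorname{Fix}T=\bigcap_{i=1}^m\operatorname{Fix}T_i$; (iv) if every $T_i$, $i\in I$, satisfies the demi closedness principle, then $T$ also satisfies the demi closedness principle.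
   Context: $\mathcal H$ is a real Hilbert space with $\mathcal H\neq\{0\}$. For $T:\mathcal H\to\mathcal H$, $\operatorname{Fix}T:=\{z\in\mathcal H: T(z)=z\}$. For $\lambda>0$, an operator $T$ with $\operatorname{Fix}T\ne\emptyset$ is a $\lambda$-relaxed cutter if $\lambda\langle z-x,T(x)-x\rangle\ge\|T(x)-x\|^2$ for all $x\in\mathcal H$ and $z\in\operatorname{Fix}T$. An operator $T$ satisfies the demi closedness principle if for any bounded sequence $\{x^k\}$ with $\|T(x^k)-x^k\|\to0$, every weak cluster point $y$ of $\{x^k\}$ belongs to $\operatorname{Fix}T$. *)

(* Defs.v *)
From HB Require Import structures.
From mathcomp Require Import all_boot all_order all_algebra.
From mathcomp Require Import all_classical all_reals all_analysis.

Set Implicit Arguments.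
Unset Strict Implicit.
Unset Printing Implicit Defensive.

Import Order.TTheory GRing.Theory Num.Theory.
Import numFieldNormedType.Exports.

Local Open Scope classical_set_scope.
Local Open Scope ring_scope.

(* [{dot V for idfun}] is the type of symmetric, positive definite bilinear
   forms on [V]; completeness comes from [CompleteNormedModule]. *)
HB.mixin Record CompleteNormedModule_isHilbert (R : realType) V
    of CompleteNormedModule R V := {
  inner : {dot V for (@idfun R)} ;
  inner_normE : forall x : V, `|x| = Num.sqrt (inner x x)
}.

#[short(type="hilbertType")]
HB.structure Definition Hilbert (R : realType) :=
  {V of CompleteNormedModule R V & CompleteNormedModule_isHilbert R V}.

Arguments inner {R s} : rename.

Notation "'<<|' x , y '|>>'" := (inner x y)
  (at level 0, x at level 99, y at level 99, format "<<| x ,  y |>>")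
  : ring_scope.

Section Operators.
Context {R : realType} {H : hilbertType R}.
Implicit Types (T : H -> H).

Definition Fix T : set H := [set z | T z = z].

Definition relaxed_cutter (lambda : R) T : Prop :=
  [/\ 0 < lambda, Fix T !=set0 &
      forall x z : H, Fix T z ->
        `|T x - x| ^+ 2 <= lambda * <<| z - x, T x - x |>>].

Definition weak_cvg (x : H^nat) (y : H) : Prop :=
  forall v : H, <<| x k, v |>> @[k --> \oo] --> <<| y, v |>>.

(* Weak cluster points are taken sequentially: weak limits of subsequences.
   For bounded sequences of a Hilbert space this agrees with the cluster
   points for the weak topology. *)
Definition weak_cluster_point (x : H^nat) (y : H) : Prop :=
  exists2 phi : nat -> nat, increasing_seq phi & weak_cvg (x \o phi) y.

Definition demiclosedness_principle T : Prop :=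
  forall x : H^nat, bounded_fun x ->
    `|T (x k) - x k| @[k --> \oo] --> (0 : R) ->
    forall y, weak_cluster_point x y -> Fix T y.

End Operators.

(* Main.v *)
Require Import Defs.
From HB Require Import structures.
From mathcomp Require Import all_boot all_order all_algebra.
From mathcomp Require Import all_classical all_reals all_analysis.
From mathcomp Require Import ring lra.

Set Implicit Arguments.
Unset Strict Implicit.
Unset Printing Implicit Defensive.

Import Order.TTheory GRing.Theory Num.Theory.
Import numFieldNormedType.Exports.

Local Open Scope classical_set_scope.
Local Open Scope ring_scope.

(** Given a common fixed point [z], summing the cutter inequalities
    [|d_i|^2 / lambda_i <= <z - x, d_i>] of the displacements
    [d_i = T_i x - x] with weights [w_i] gives
    [\sum_i (w_i / lambda_i) |d_i|^2 <= <z - x, T x - x>]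
    ([sum_sqr_displacement_le]), because the displacement of the average [T]
    is the average of the displacements.  Everything follows from this bound.

    By convexity of the squared norm ([sqr_norm_wsum_le]), the left-hand side
    is at least [|T x - x|^2 / lambda] with [lambda = \sum_i w_i lambda_i];
    this is the cutter inequality of [T] at a common fixed point.  If [x] is
    fixed by [T] the right-hand side vanishes, hence so does every [d_i]: the
    fixed points of [T] are the common fixed points, so the cutter inequality
    was in fact proved at all points of [Fix T].  Finally, along a bounded
    sequence the right-hand side is [O(|T x - x|)] by the Cauchy-Schwarz
    inequality, so a sequence of almost fixed points of [T] is one of almost
    fixed points of each [T_i], and demi-closedness passes from the [T_i] to
    [T]. *)

(** * Inner products *)

Section InnerProduct.
Context {R : realType} {H : hilbertType R}.
Implicit Types u v : H.

Lemma innerC u v : <<| u, v |>> = <<| v, u |>>.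
Proof. by rewrite (@hermC _ _ _ _ inner) expr0 mul1r. Qed.

Lemma innerZr (a : R) u v : <<| u, a *: v |>> = a * <<| u, v |>>.
Proof. by rewrite linearZr_LR. Qed.

Lemma inner_sumr (I : finType) u (v : I -> H) :
  <<| u, \sum_i v i |>> = \sum_i <<| u, v i |>>.
Proof. by rewrite linear_sumr. Qed.

Lemma inner_ge0 u : 0 <= <<| u, u |>>.
Proof.
have [->|u0] := eqVneq u 0; first by rewrite linear0r.
exact/ltW/neq0_dnorm_gt0.
Qed.

Lemma inner_sqr_norm u : <<| u, u |>> = `|u| ^+ 2.
Proof. by rewrite inner_normE sqr_sqrtr// inner_ge0. Qed.

Lemma sqr_normD u v :
  `|u + v| ^+ 2 = `|u| ^+ 2 + 2 * <<| u, v |>> + `|v| ^+ 2.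
Proof.
rewrite -!inner_sqr_norm linearDl/= !linearDr/= (innerC v u).
by ring.
Qed.

(** The triangle inequality is part of the normed structure, and squaring it
    leaves exactly the Cauchy-Schwarz inequality. *)
Lemma inner_le_norm u v : <<| u, v |>> <= `|u| * `|v|.
Proof.
have : `|u + v| ^+ 2 <= (`|u| + `|v|) ^+ 2.
  by rewrite lerXn2r ?nnegrE ?addr_ge0// ler_normD.
by rewrite sqr_normD; lra.
Qed.

End InnerProduct.

(** * Weighted averages *)

Section WeightedSums.
Context {R : realType} {I : finType}.
Variables (w : I -> R).
Hypothesis w_gt0 : forall i, 0 < w i.

Lemma le_wavg (a : I -> R) (r : R) :
  \sum_i w i = 1 -> (forall i, r <= a i) -> r <= \sum_i w i * a i.
Proof.
move=> w1 ra; rewrite -[leLHS]mul1r -w1 mulr_suml.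
by apply: ler_sum => i _; rewrite ler_pM2l.
Qed.

Lemma ge_wavg (a : I -> R) (r : R) :
  \sum_i w i = 1 -> (forall i, a i <= r) -> \sum_i w i * a i <= r.
Proof.
move=> w1 ar; rewrite -[leRHS]mul1r -w1 mulr_suml.
by apply: ler_sum => i _; rewrite ler_pM2l.
Qed.

(** The minimum is taken in the extended reals; it is finite as soon as there
    is an index, and is then a lower bound to which [le_wavg] applies. *)
Lemma bigmin_le_wavg (a : I -> R) : I -> \sum_i w i = 1 ->
  (\big[Order.min/+oo]_i (a i)%:E <= (\sum_i w i * a i)%:E)%E.
Proof.
move=> i0 w1.
have min_le i : (\big[Order.min/+oo]_i (a i)%:E <= (a i)%:E)%E.
  exact: bigmin_le.
case: (\big[_/_]_i _)%E min_le => [r| |] min_le.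
- by rewrite lee_fin; apply: le_wavg => // i; rewrite -lee_fin.
- by have := min_le i0; rewrite leye_eq.
- exact: leNye.
Qed.

Lemma wavg_le_bigmax (a : I -> R) : I -> \sum_i w i = 1 ->
  ((\sum_i w i * a i)%:E <= \big[Order.max/-oo]_i (a i)%:E)%E.
Proof.
move=> i0 w1.
have le_max i : ((a i)%:E <= \big[Order.max/-oo]_i (a i)%:E)%E.
  exact: (le_bigmax _ (fun i => (a i)%:E)).
case: (\big[_/_]_i _)%E le_max => [r| |] le_max.
- by rewrite lee_fin; apply: ge_wavg => // i; rewrite -lee_fin.
- exact: leey.
- by have := le_max i0; rewrite leeNy_eq.
Qed.

(** With [L = \sum_i w_i l_i] and [s = \sum_i w_i v_i], this is the
    nonnegativity of [\sum_i (w_i / l_i) |v_i - (l_i / L) s|^2], which is [L]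
    times the variance of the vectors [v_i / l_i] under the weights
    [w_i l_i / L]. *)
Lemma sqr_norm_wsum_le {H : hilbertType R} (l : I -> R) (v : I -> H) :
    (forall i, 0 < l i) ->
  `|\sum_i w i *: v i| ^+ 2 <=
    (\sum_i w i * l i) * \sum_i w i / l i * `|v i| ^+ 2.
Proof.
move=> l_gt0; set s := \sum_i w i *: v i; set L := \sum_i w i * l i.
set Q := \sum_i w i / l i * _.
have wl_ge0 i : 0 <= w i * l i by rewrite mulr_ge0// ltW.
have [L0|L_neq0] := eqVneq L 0.
  (* A sum of positive terms is zero only when the index type is empty. *)
  have Iempty (i : I) : False.
    have /(_ i isT)/eqP := psumr_eq0P (fun j _ => wl_ge0 j) L0.
    by rewrite gt_eqF// mulr_gt0.
  by rewrite L0 mul0r /s big1 ?normr0 ?expr0n// => i; case: (Iempty i).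
have L_gt0 : 0 < L by rewrite lt_def L_neq0 sumr_ge0.
have expand : \sum_i w i / l i * `|v i + (- (l i / L)) *: s| ^+ 2 =
    Q - `|s| ^+ 2 / L.
  transitivity (\sum_i (w i / l i * `|v i| ^+ 2
      + (- 2 / L) * <<| s, w i *: v i |>>
      + (w i * l i) * (`|s| ^+ 2 / L ^+ 2))).
    apply: eq_bigr => i _.
    rewrite sqr_normD normrZ exprMn real_normK ?num_real//.
    rewrite (innerZr _ (v i)) (innerC (v i)) (innerZr _ s).
    by field; rewrite L_neq0 gt_eqF.
  rewrite !big_split/= -mulr_sumr -mulr_suml -inner_sumr inner_sqr_norm.
  by rewrite -/Q -/L; field.
have : 0 <= Q - `|s| ^+ 2 / L.
  rewrite -expand; apply: sumr_ge0 => i _.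
  by rewrite mulr_ge0 ?sqr_ge0// ltW// divr_gt0.
by rewrite subr_ge0 ler_pdivrMr// mulrC.
Qed.

End WeightedSums.

(** * Averages of relaxed cutters *)

Section Average.
Context {R : realType} {H : hilbertType R} {I : finType}.
Variables (T_ : I -> H -> H) (l w : I -> R).
Hypotheses (l_gt0 : forall i, 0 < l i) (w_gt0 : forall i, 0 < w i).
Hypothesis w_sum1 : \sum_i w i = 1.
Hypothesis T_cutter : forall i, relaxed_cutter (l i) (T_ i).
Hypothesis T_Fix : \bigcap_i Fix (T_ i) !=set0.

Let T x := \sum_i w i *: T_ i x.

Lemma wavg_displacement x : T x - x = \sum_i w i *: (T_ i x - x).
Proof.
under [RHS]eq_bigr do rewrite scalerBr.
by rewrite sumrB -scaler_suml w_sum1 scale1r.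
Qed.

Lemma sum_sqr_displacement_le x z : (\bigcap_i Fix (T_ i)) z ->
  \sum_i w i / l i * `|T_ i x - x| ^+ 2 <= <<| z - x, T x - x |>>.
Proof.
move=> Fz; rewrite wavg_displacement inner_sumr; apply: ler_sum => i _.
rewrite innerZr -mulrA ler_pM2l// mulrC ler_pdivrMr// mulrC.
by have [_ _ ->] := T_cutter i; last exact: Fz.
Qed.

(** All terms of the sum are nonnegative, so each one alone is controlled. *)
Lemma sqr_displacement_le x z i : (\bigcap_i Fix (T_ i)) z ->
  `|T_ i x - x| ^+ 2 <= l i / w i * <<| z - x, T x - x |>>.
Proof.
move=> Fz; rewrite -[l i / w i]invf_div ler_pdivlMl ?divr_gt0//.
apply: le_trans (sum_sqr_displacement_le x Fz).
rewrite (bigD1 i)//= lerDl sumr_ge0// => j _.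
by rewrite mulr_ge0 ?sqr_ge0// ltW// divr_gt0.
Qed.

Lemma Fix_wavg : Fix T = \bigcap_i Fix (T_ i).
Proof.
have [z Fz] := T_Fix.
apply/seteqP; split => x /= Fx; last first.
  apply/eqP; rewrite -subr_eq0 wavg_displacement big1// => i _.
  by have -> : T_ i x = x; [exact: Fx|rewrite subrr scaler0].
move=> i _; apply/eqP; rewrite -subr_eq0 -normr_eq0 -sqrf_eq0.
have := sqr_displacement_le x i Fz.
by rewrite Fx subrr linear0r mulr0 => h; rewrite eq_le h sqr_ge0.
Qed.

(** The hypothesis [I] gives an index, without which the relaxation parameter
    would be an empty sum, hence zero. *)
Lemma relaxed_cutter_wavg : I -> relaxed_cutter (\sum_i w i * l i) T.
Proof.
move=> i0.
have L_gt0 : 0 < \sum_i w i * l i.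
  rewrite (bigD1 i0)//= ltr_pwDl ?mulr_gt0// sumr_ge0// => i _.
  by rewrite mulr_ge0// ltW.
split => //; first by rewrite Fix_wavg.
move=> x z; rewrite Fix_wavg => Fz; rewrite {1}wavg_displacement.
apply: le_trans (sqr_norm_wsum_le w_gt0 _ l_gt0) _.
by rewrite ler_pM2l// sum_sqr_displacement_le.
Qed.

(** The sequence stays at distance at most [|z| + M] from a common fixed point
    [z], so [|T_i x_k - x_k|^2] is at most a constant times [|T x_k - x_k|]. *)
Lemma demiclosedness_principle_wavg :
  (forall i, demiclosedness_principle (T_ i)) -> demiclosedness_principle T.
Proof.
move=> T_demi x x_bnd Tx y xy; rewrite Fix_wavg => i _.
apply: (T_demi i x x_bnd _ y xy).
have [z Fz] := T_Fix.
have [M M_gt0 x_le] := pinfty_ex_gt0 x_bnd.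
pose C := l i / w i * (`|z| + M).
have C_cvg : C * `|T (x k) - x k| @[k --> \oo] --> (0 : R).
  by rewrite -(mulr0 C); apply: cvgMl_tmp.
have sqr_cvg : `|T_ i (x k) - x k| ^+ 2 @[k --> \oo] --> (0 : R).
  apply: (squeeze_cvgr _ (cvg_cst 0) C_cvg).
  apply: nearW => k; rewrite sqr_ge0/=.
  apply: le_trans (sqr_displacement_le (x k) i Fz) _.
  rewrite /C -[leRHS]mulrA ler_pM2l ?divr_gt0//.
  apply: le_trans (inner_le_norm _ _) _.
  rewrite ler_wpM2r//; apply: le_trans (ler_normB _ _) _.
  by rewrite lerD2l; exact: x_le.
rewrite -sqrtr0; under eq_fun do rewrite -[`|_|]ger0_norm// -sqrtr_sqr.
exact: (continuous_cvg _ (@sqrt_continuous R 0) sqr_cvg).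
Qed.

End Average.

Theorem theorem3p3 (R : realType) (H : hilbertType R)
    (H_neq0 : exists x : H, x != 0)
    (m : nat) (m_ge1 : (1 <= m)%N)
    (T_ : 'I_m -> H -> H) (lambda_ : 'I_m -> R)
    (lambda_gt0 : forall i, 0 < lambda_ i)
    (T_cutter : forall i, relaxed_cutter (lambda_ i) (T_ i))
    (T_Fix : \bigcap_i Fix (T_ i) !=set0)
    (w : 'I_m -> R) (w_gt0 : forall i, 0 < w i)
    (w_sum1 : \sum_(i < m) w i = 1) :
  let T : H -> H := fun x => \sum_(i < m) w i *: T_ i x in
  let lambda : R := \sum_(i < m) w i * lambda_ i in
  [/\ relaxed_cutter lambda T,
      [/\ (0 < \big[Order.min/+oo]_(i < m) (lambda_ i)%:E)%E,
          (\big[Order.min/+oo]_(i < m) (lambda_ i)%:E <= lambda%:E)%E,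
          (lambda%:E <= \big[Order.max/-oo]_(i < m) (lambda_ i)%:E)%E &
          (\big[Order.max/-oo]_(i < m) (lambda_ i)%:E < +oo)%E],
      Fix T = \bigcap_i Fix (T_ i) &
      (forall i, demiclosedness_principle (T_ i)) ->
        demiclosedness_principle T].
Proof.
move=> T lambda.
have i0 : 'I_m := Ordinal m_ge1.
split.
- exact: relaxed_cutter_wavg.
- split.
  + by apply: lt_bigmin => // i _; rewrite lte_fin.
  + exact: bigmin_le_wavg.
  + exact: wavg_le_bigmax.
  + by apply: bigmax_lt => // i _; rewrite ltry.
- exact: (Fix_wavg lambda_gt0).
- exact: (demiclosedness_principle_wavg lambda_gt0).
Qed.
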